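(* Let $f:\mathbb{R}^n\to\mathbb{R}$ be continuously differentiable and let $\{x_k\}$ be an infinite sequence generated by Algorithm TBB (in any of its six variants) applied to $\min_{x\in\mathbb{R}^n} f(x)$. Then: (i) either $f(x_k)\to-\infty$ as $k\to\infty$, or $\liminf_{k\to\infty}\|\nabla f(x_k)\|=0$; (ii) if $\nabla f$ is uniformly continuous on $\mathbb{R}^n$, then either $f(x_k)\to-\infty$ as $k\to\infty$, or $\lim_{k\to\infty}\|\nabla f(x_k)\|=0$.
   Context: Algorithm TBB (three-point step size gradient method with relaxed generalized Armijo step size rule). Write $g_k=\nabla f(x_k)$. Parameters: $\mu_1,\mu_2\in(0,1)$ with $\mu_1\le\mu_2$; $\gamma_1,\gamma_2>0$; $\sigma_1\in(0,1)$; $\sigma_2\in(1,2)$; $0<\alpha_{\min}<\alpha_{\max}$; $0<\omega<1$. Start from $x_{-1}=x_0\in\mathbb{R}^n$ and $\bar\alpha_0=1$, $k=0$. At iteration $k$: (1) If $g_k=0$, stop; otherwise set $d_k=-\bar\alpha_k g_k$. (2) Choose a number $L_k$ with $0\le L_k\le \bar\alpha_k(-g_k^Td_k)/\|d_k\|^2$. Set $x_{k+1}=x_k+\lambda_kd_k$ with $\lambda_k=\omega^{p_k}$, where $p_k$ is the smallest non-negative integer for which $\lambda_k$ satisfies both (a) $f(x_k+\lambda_kd_k)\le f(x_k)+\mu_1\lambda_k\left(g_k^Td_k+\frac{1}{2\bar\alpha_k}L_k\|d_k\|^2\right)$, and (b) $\lambda_k\ge\gamma_1$, or $\lambda_k\ge\gamma_2\lambda_k^*>0$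 for some $\lambda_k^*$ with $f(x_k+\lambda_k^*d_k)>f(x_k)+\mu_2\lambda_k^*\left(g_k^Td_k+\frac{1}{2\bar\alpha_k}L_k\|d_k\|^2\right)$. (3) Replace $k$ by $k+1$. With $s_{k-1}=x_k-x_{k-1}$, $s_{k-2}=x_k-x_{k-2}$, $y_{k-1}=g_k-g_{k-1}$, $y_{k-2}=g_k-g_{k-2}$, let $\beta_k=\frac{s_{k-1}^Ty_{k-1}}{\|y_{k-1}\|^2}$ and let $\alpha_k$ be given by one fixed choice among the following six formulas (one per variant): BB1: $\alpha_k=\alpha_k^{BB_1}:=\frac{\|s_{k-1}\|^2}{s_{k-1}^Ty_{k-1}}$; BB2: $\alpha_k=\alpha_k^{BB_2}:=\frac{s_{k-1}^Ty_{k-1}}{\|y_{k-1}\|^2}$; TBB1: $\alpha_k=\frac{\|s_{k-1}\|^2+\|s_{k-2}\|^2}{s_{k-1}^Ty_{k-1}+s_{k-2}^Ty_{k-2}}$; TBB2: $\alpha_k=\frac{s_{k-1}^Ty_{k-1}+s_{k-2}^Ty_{k-2}}{\|y_{k-1}\|^2+\|y_{k-2}\|^2}$; TBB1$'$: $\alpha_k=\lambda\alpha_k^{BB_1}+(1-\lambda)\alpha_k^{BB_2}$ with $\lambda=\left(\frac{\|s_{k-2}\|^2}{y_{k-2}^Ts_{k-2}}-\alpha_k^{BB_2}\right)/(\alpha_k^{BB_1}-\alpha_k^{BB_2})$; TBB2$'$: $\alpha_k=\lambda\alpha_k^{BB_1}+(1-\lambda)\alpha_k^{BB_2}$ with $\lambda=\left(\frac{y_{k-2}^Ts_{k-2}}{\|y_{k-2}\|^2}-\alpha_k^{BB_2}\right)/(\alpha_k^{BB_1}-\alpha_k^{BB_2})$.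 Put $\bar\alpha_{\min}=\max\{\alpha_{\min},\sigma_1|\beta_k|\}$ and $\bar\alpha_{\max}=\min\{\alpha_{\max},\sigma_2|\beta_k|\}$. Set $\bar\alpha_k=\alpha_k$ if $\bar\alpha_{\min}\le\alpha_k\le\bar\alpha_{\max}$; $\bar\alpha_k=\bar\alpha_{\min}$ if $\alpha_k<\bar\alpha_{\min}$; $\bar\alpha_k=\bar\alpha_{\max}$ if $\alpha_k>\bar\alpha_{\max}$. Return to (1). Standing assumptions: all quantities above are well defined at every iteration and the algorithm does not stop, so that $\{x_k\}$ is infinite; $\alpha_{\min}\le\beta_k\le\alpha_{\max}$ for all $k\ge1$, and $\alpha_{\min}\le 1\le\alpha_{\max}$. (Consequently $\alpha_{\min}\le\bar\alpha_k\le\alpha_{\max}$ for all $k$.) *)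

(* Defs.v *)
From mathcomp Require Import all_boot all_order all_algebra.
From mathcomp Require Import all_classical all_reals all_analysis.
Set Implicit Arguments.
Unset Strict Implicit.
Unset Printing Implicit Defensive.
Import Order.TTheory GRing.Theory Num.Theory.
Import numFieldNormedType.Exports.
Local Open Scope classical_set_scope.
Local Open Scope ring_scope.

Definition dot (R : realType) (n : nat) (u v : 'rV[R]_n) : R :=
  \sum_(i < n) u 0 i * v 0 i.

(* The norm `|v| of 'rV[R]_n is the sup norm. It induces the same topology and
   uniformity as the Euclidean norm, but the algorithm uses Euclidean lengths. *)
Definition enorm (R : realType) (n : nat) (v : 'rV[R]_n) : R :=
  Num.sqrt (dot v v).

Definition grad (R : realType) (n : nat) (f : 'rV[R]_n -> R) (x : 'rV[R]_n)
    : 'rV[R]_n :=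
  \row_(i < n) 'D_(delta_mx 0 i) f x.

Definition continuously_differentiable (R : realType) (n : nat)
    (f : 'rV[R]_n -> R) : Prop :=
  (forall x, differentiable f x) /\ continuous (grad f).

Record tbb_params (R : realType) := TbbParams {
  mu1 : R; mu2 : R;
  gamma1 : R; gamma2 : R;
  sigma1 : R; sigma2 : R;
  alpha_min : R; alpha_max : R;
  omega : R;
  mu1_bounds : 0 < mu1 < 1;
  mu2_bounds : 0 < mu2 < 1;
  mu1_le_mu2 : mu1 <= mu2;
  gamma1_gt0 : 0 < gamma1;
  gamma2_gt0 : 0 < gamma2;
  sigma1_bounds : 0 < sigma1 < 1;
  sigma2_bounds : 1 < sigma2 < 2;
  alpha_min_gt0 : 0 < alpha_min;
  alpha_min_lt_max : alpha_min < alpha_max;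
  omega_bounds : 0 < omega < 1
}.

Variant tbb_variant := BB1 | BB2 | TBB1 | TBB2 | TBB1' | TBB2'.

Section StepSizeFormulas.
Variables (R : realType) (n : nat).
Implicit Types s y : 'rV[R]_n.

Definition bb1 s y : R := enorm s ^+ 2 / dot s y.
Definition bb2 s y : R := dot s y / enorm y ^+ 2.

(* The arguments s1 y1 s2 y2 of the next definitions stand for
   s_{k-1} y_{k-1} s_{k-2} y_{k-2}. *)

Definition bb_mix s1 y1 (t : R) : R :=
  let lambda := (t - bb2 s1 y1) / (bb1 s1 y1 - bb2 s1 y1) in
  lambda * bb1 s1 y1 + (1 - lambda) * bb2 s1 y1.

Definition alpha_formula (v : tbb_variant) s1 y1 s2 y2 : R :=
  match v with
  | BB1 => bb1 s1 y1
  | BB2 => bb2 s1 y1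
  | TBB1 => (enorm s1 ^+ 2 + enorm s2 ^+ 2) / (dot s1 y1 + dot s2 y2)
  | TBB2 => (dot s1 y1 + dot s2 y2) / (enorm y1 ^+ 2 + enorm y2 ^+ 2)
  | TBB1' => bb_mix s1 y1 (enorm s2 ^+ 2 / dot y2 s2)
  | TBB2' => bb_mix s1 y1 (dot y2 s2 / enorm y2 ^+ 2)
  end.

(* Division is total (x / 0 = 0), so the requirement that the formulas be well
   defined is the explicit non-vanishing of their denominators. Every variant
   also needs |y1| != 0 for beta_k, which is required in tbb_sequence and is not
   repeated for the BB2 terms of TBB1' and TBB2'. *)
Definition alpha_defined (v : tbb_variant) s1 y1 s2 y2 : Prop :=
  match v with
  | BB1 => dot s1 y1 != 0
  | BB2 => enorm y1 ^+ 2 != 0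
  | TBB1 => dot s1 y1 + dot s2 y2 != 0
  | TBB2 => enorm y1 ^+ 2 + enorm y2 ^+ 2 != 0
  | TBB1' => [/\ dot s1 y1 != 0, dot y2 s2 != 0 & bb1 s1 y1 != bb2 s1 y1]
  | TBB2' => [/\ dot s1 y1 != 0, enorm y2 ^+ 2 != 0
               & bb1 s1 y1 != bb2 s1 y1]
  end.

End StepSizeFormulas.

Section Algorithm.
Variables (R : realType) (n : nat).
Variables (P : tbb_params R) (f : 'rV[R]_n -> R).

Definition truncated_step (alpha beta : R) : R :=
  let lo := Num.max (alpha_min P) (sigma1 P * `|beta|) in
  let hi := Num.min (alpha_max P) (sigma2 P * `|beta|) in
  if lo <= alpha <= hi then alpha else if alpha < lo then lo else hi.

(* lam' is a trial step that violates sufficient decrease with constant mu2. *)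
Definition acceptable_step (x d : 'rV[R]_n) (abar L lam : R) : Prop :=
  let slope := dot (grad f x) d + 1 / (2 * abar) * L * enorm d ^+ 2 in
  f (x + lam *: d) <= f x + mu1 P * lam * slope
  /\ (gamma1 P <= lam
      \/ exists lam' : R,
           [/\ gamma2 P * lam' <= lam, 0 < gamma2 P * lam'
             & f x + mu2 P * lam' * slope < f (x + lam' *: d)]).

(* The first clause for each k, g k != 0, says that the algorithm never stops.
   L is the sequence of free choices and p the backtracking exponents. *)
Definition tbb_sequence (v : tbb_variant) (x : nat -> 'rV[R]_n)
    (abar L : nat -> R) (p : nat -> nat) : Prop :=
  let g k := grad f (x k) in
  let d k := - abar k *: g k in
  abar 0%N = 1
  /\ (forall k,
        [/\ g k != 0,
            0 <= L k <= abar k * (- dot (g k) (d k)) / enorm (d k) ^+ 2,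
            acceptable_step (x k) (d k) (abar k) (L k) (omega P ^+ p k),
            (forall q, (q < p k)%N ->
               ~ acceptable_step (x k) (d k) (abar k) (L k) (omega P ^+ q))
          & x k.+1 = x k + omega P ^+ p k *: d k])
  (* The update at iteration k.+1. The point two iterations back is x k.-1:
     for k = 0 it is x_{-1} = x_0, which agrees with 0.-1 = 0. *)
  /\ (forall k,
        let s1 := x k.+1 - x k in let s2 := x k.+1 - x k.-1 in
        let y1 := g k.+1 - g k in let y2 := g k.+1 - g k.-1 in
        let beta := dot s1 y1 / enorm y1 ^+ 2 in
        [/\ enorm y1 ^+ 2 != 0,
            alpha_defined v s1 y1 s2 y2,
            alpha_min P <= beta <= alpha_max P
          & abar k.+1 = truncated_step (alpha_formula v s1 y1 s2 y2) beta]).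

End Algorithm.

(* Main.v *)
Require Import Defs.
From mathcomp Require Import all_boot all_order all_algebra.
From mathcomp Require Import all_classical all_reals all_analysis.
From mathcomp Require Import ring lra.
Set Implicit Arguments.
Unset Strict Implicit.
Unset Printing Implicit Defensive.
Import Order.TTheory GRing.Theory Num.Theory.
Import numFieldNormedType.Exports.
Local Open Scope classical_set_scope.
Local Open Scope ring_scope.

(** Write [g k] for the gradient at [x k], [lam k] for the accepted step size
and [d k = - abar k *: g k] for the direction. The bound on [L k] is exactly
[L k <= 1], so the relaxed slope of the Armijo test lies between
[- abar k * |g k|^2] and half of it ([slope_bounds]). As [abar k] stays in
[[alpha_min, alpha_max]] whatever formula proposed it
([truncated_step_bounds]), the six variants need not be told apart.

Test (a) gives a decrease of [f] of order [lam k * |g k|^2]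
([tbb_decrease]). Hence [f (x k)] either tends to [-oo] or converges, and in
the latter case [lam k * |g k|^2] tends to [0]. Test (b) says that a step below
[gamma1] is comparable to a trial step that failed the descent test; by the
mean value theorem the gradient then changes by a fixed fraction of [|g k|]
within distance of order [lam k * |g k|] of [x k] ([tbb_short_step]).

If [|g k| >= e], the smallness of [lam k * |g k|^2] makes [lam k] and
[lam k * |g k|] small as well. So a large gradient forces a short step, and a
short step forces a jump of the gradient near [x k]. Any control of
the oscillation of the gradient on balls of a fixed radius around the late
iterates excludes the jump ([run_grad_small]). For uniformly continuous
gradients the control is immediate ([run_grad_cvg0]). In general, if [|g k|]
stayed above [e], the displacements would be bounded by a multiple of the
decreases of [f], the iterates would converge, and continuity of the gradient at
their limit would give the control ([run_grad_frequently_small]).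

The library norm on row vectors is the sup norm. It is dominated by the
Euclidean length, which is enough for all the distances; inner products are
estimated with one factor in each norm, at the price of a factor [n]. *)

(** * Euclidean length and sup norm *)

Lemma norm_coord_le (R : realType) (n : nat) (u : 'rV[R]_n) (i : 'I_n) :
  `|u 0 i| <= `|u|.
Proof.
by rewrite [leRHS]mx_normrE; apply/bigmax_geP; right; exists (0, i).
Qed.

Lemma sqr_coord_le_dot (R : realType) (n : nat) (u : 'rV[R]_n) (i : 'I_n) :
  u 0 i ^+ 2 <= dot u u.
Proof.
rewrite /dot (bigD1 i)//= -expr2 lerDl; apply: sumr_ge0 => j _.
by rewrite -expr2 sqr_ge0.
Qed.

Lemma dot_ge0 (R : realType) (n : nat) (u : 'rV[R]_n) : 0 <= dot u u.
Proof. by apply: sumr_ge0 => i _; rewrite -expr2 sqr_ge0. Qed.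

Lemma enorm_ge0 (R : realType) (n : nat) (u : 'rV[R]_n) : 0 <= enorm u.
Proof. exact: sqrtr_ge0. Qed.

Lemma sqr_enorm (R : realType) (n : nat) (u : 'rV[R]_n) :
  enorm u ^+ 2 = dot u u.
Proof. by rewrite sqr_sqrtr ?dot_ge0. Qed.

Lemma coord_le_enorm (R : realType) (n : nat) (u : 'rV[R]_n) (i : 'I_n) :
  `|u 0 i| <= enorm u.
Proof.
rewrite -(ler_pXn2r (n := 2))// ?nnegrE ?enorm_ge0// sqr_enorm real_normK ?num_real//.
exact: sqr_coord_le_dot.
Qed.

Lemma norm_le_enorm (R : realType) (n : nat) (u : 'rV[R]_n) : `|u| <= enorm u.
Proof.
rewrite [leLHS]mx_normrE; apply/bigmax_leP; split; first exact: enorm_ge0.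
by case=> i j _ /=; rewrite (ord1 i) coord_le_enorm.
Qed.

Lemma enorm_gt0 (R : realType) (n : nat) (u : 'rV[R]_n) : u != 0 -> 0 < enorm u.
Proof. by move=> u0; rewrite (lt_le_trans _ (norm_le_enorm u))// normr_gt0. Qed.

(** Mixing the two norms replaces the Cauchy-Schwarz inequality: the sup norm is
the one in which the continuity of the gradient is expressed. *)
Lemma norm_dot_le (R : realType) (n : nat) (u w : 'rV[R]_n) :
  `|dot u w| <= n%:R * (`|u| * enorm w).
Proof.
apply: le_trans (ler_norm_sum _ _ _) _.
apply: (@le_trans _ _ (\sum_(i < n) `|u| * enorm w)).
  apply: ler_sum => i _; rewrite normrM ler_pM//; first exact: norm_coord_le.
  exact: coord_le_enorm.
by rewrite sumr_const card_ord mulr_natl.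
Qed.

Lemma dotZr (R : realType) (n : nat) (a : R) (u w : 'rV[R]_n) :
  dot u (a *: w) = a * dot u w.
Proof. by rewrite /dot mulr_sumr; apply: eq_bigr => i _; rewrite mxE mulrCA. Qed.

Lemma dotZl (R : realType) (n : nat) (a : R) (u w : 'rV[R]_n) :
  dot (a *: u) w = a * dot u w.
Proof. by rewrite /dot mulr_sumr; apply: eq_bigr => i _; rewrite mxE mulrA. Qed.

Lemma dotBl (R : realType) (n : nat) (u w z : 'rV[R]_n) :
  dot (u - w) z = dot u z - dot w z.
Proof.
by rewrite /dot -sumrB; apply: eq_bigr => i _; rewrite !mxE mulrBl.
Qed.

(** * The gradient and the mean value theorem *)

Lemma derive_grad (R : realType) (n : nat) (f : 'rV[R]_n -> R)
    (x d : 'rV[R]_n) :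
  differentiable f x -> 'D_d f x = dot (grad f x) d.
Proof.
move=> df; rewrite deriveE// {1}(row_sum_delta d) linear_sum /dot.
apply: eq_bigr => i _; rewrite linearZ /= /grad mxE mulrC deriveE//.
Qed.

Lemma MVT_grad (R : realType) (n : nat) (f : 'rV[R]_n -> R)
    (x d : 'rV[R]_n) (s : R) :
  (forall z, differentiable f z) -> 0 < s ->
  exists2 t, 0 < t < s &
    f (x + s *: d) - f x = s * dot (grad f (x + t *: d)) d.
Proof.
move=> df s0; pose phi (t : R) := f (x + t *: d).
have dphi (t : R) : is_derive t 1 phi (dot (grad f (x + t *: d)) d).
  (* The difference quotients of phi at t are those of f along d. *)
  have quotE : (fun h : R => h^-1 *: ((phi \o shift t) (h *: 1) - phi t)) =
      (fun h => h^-1 *: ((f \o shift (x + t *: d)) (h *: d) - f (x + t *: d))).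
    apply/funext => h; rewrite /phi /=; congr (_ *: (f _ - _)).
    by rewrite [h *: 1]mulr1 scalerDl addrCA.
  have -> : dot (grad f (x + t *: d)) d = 'D_1 phi t.
    by rewrite -derive_grad// /derive quotE.
  apply/derivableP; rewrite /derivable quotE.
  exact: diff_derivable.
have cphi : {within `[0, s], continuous phi}.
  apply: derivable_within_continuous => t _.
  exact: (@ex_derive _ _ _ _ _ _ _ (dphi t)).
have [t] := MVT s0 (fun t _ => dphi t) cphi.
rewrite in_itv /= => t0s; rewrite /phi scale0r addr0 subr0 mulrC => E.
by exists t.
Qed.

(** * Descent runs in which short steps reveal a jump of the gradient *)

(** What the convergence proof retains of a line search method, with constants
independent of the iteration. *)
Record descent_run (R : realType) (n : nat) (f : 'rV[R]_n -> R)
    (x : nat -> 'rV[R]_n) (lam : nat -> R) (c A g1 B b : R) : Prop := {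
  run_c_gt0 : 0 < c;
  run_A_gt0 : 0 < A;
  run_g1_gt0 : 0 < g1;
  run_B_gt0 : 0 < B;
  run_b_gt0 : 0 < b;
  run_lam_gt0 : forall k, 0 < lam k;
  run_decrease : forall k,
    c * (lam k * enorm (grad f (x k)) ^+ 2) <= f (x k) - f (x k.+1);
  run_move : forall k, `|x k.+1 - x k| <= A * (lam k * enorm (grad f (x k)));
  run_short_step : forall k, lam k < g1 ->
    exists2 xi, `|xi - x k| <= B * (lam k * enorm (grad f (x k))) &
      b * enorm (grad f (x k)) <= `|grad f xi - grad f (x k)| }.

Section DescentRun.
Context (R : realType) (n : nat) (f : 'rV[R]_n -> R).
Context (x : nat -> 'rV[R]_n) (lam : nat -> R) (c A g1 B b : R).
Local Notation g k := (grad f (x k)).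
Hypothesis run : descent_run f x lam c A g1 B b.

Let c0 : 0 < c := run_c_gt0 run.
Let A0 : 0 < A := run_A_gt0 run.
Let g10 : 0 < g1 := run_g1_gt0 run.
Let B0 : 0 < B := run_B_gt0 run.
Let b0 : 0 < b := run_b_gt0 run.
Let lam0 : forall k, 0 < lam k := run_lam_gt0 run.

Lemma run_nonincreasing :
  {homo (fun k => f (x k)) : k m / (k <= m)%N >-> m <= k}.
Proof.
apply/nonincreasing_seqP => k; rewrite -subr_ge0.
apply: le_trans (run_decrease run k).
by rewrite mulr_ge0 ?(ltW c0)// mulr_ge0 ?sqr_ge0// (ltW (lam0 _)).
Qed.

Lemma run_cvgNy_or_cvg :
  f (x k) @[k --> \oo] --> -oo \/ cvgn (fun k => f (x k)).
Proof.
have [|unb] := pselect (has_lbound (range (fun k => f (x k)))).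
  by move=> lb; right; exact: nonincreasing_is_cvgn run_nonincreasing lb.
left; apply/cvgrNyPle => M.
have [K fK] : exists K, f (x K) < M.
  apply: contrapT => noK; apply: unb; exists M => _ [k _ <-].
  by rewrite leNgt; apply/negP => fM; apply: noK; exists k.
exists K => // k /= Kk; exact: le_trans (run_nonincreasing Kk) (ltW fK).
Qed.

Lemma run_cauchy (e : R) : cvgn (fun k => f (x k)) -> 0 < e ->
  exists K, forall k m, (K <= k <= m)%N -> f (x k) - f (x m) < e.
Proof.
move=> fcvg e0.
have /cvgrPdist_lt /(_ _ e0) [K _ HK] := fcvg; exists K => k m /andP[Kk km].
have lim_le := nonincreasing_cvgn_ge run_nonincreasing fcvg m.
have := HK k Kk; rewrite /= ltr_norml => /andP[+ _].
lra.
Qed.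

Lemma run_lam_sqr_small (e : R) : cvgn (fun k => f (x k)) -> 0 < e ->
  exists K, forall k, (K <= k)%N -> lam k * enorm (g k) ^+ 2 < e.
Proof.
move=> fcvg e0; have [K HK] := run_cauchy fcvg (mulr_gt0 c0 e0).
exists K => k Kk; rewrite -(ltr_pM2l c0).
by apply: le_lt_trans (run_decrease run k) _; apply: HK; rewrite Kk/=.
Qed.

(** A late gradient of length at least [e] comes with a step below [g1] and with
a jump of at least [b * e] within distance [delta], against the assumed control
of the oscillation. The modulus is only asked around the iterates, so that both
uniform continuity and convergence of the iterates can supply it. *)
Lemma run_grad_small (e delta : R) (K : nat) :
  cvgn (fun k => f (x k)) -> 0 < e -> 0 < delta ->
  (forall k xi, (K <= k)%N -> `|xi - x k| < delta ->
     `|grad f xi - g k| < b * e) ->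
  exists K', forall k, (K' <= k)%N -> enorm (g k) < e.
Proof.
move=> fcvg e0 delta0 modulus.
(* The two entries make the step shorter than g1 and the point xi closer than
   delta, respectively, as soon as the gradient is at least e. *)
have eta0 : 0 < Num.min (g1 * e ^+ 2) (delta * e / B).
  by rewrite lt_min !mulr_gt0 ?invr_gt0 ?exprn_gt0.
have [K1 small] := run_lam_sqr_small fcvg eta0.
exists (maxn K K1) => k; rewrite geq_max => /andP[Kk K1k].
rewrite ltNge; apply/negP => eg.
have := small k K1k; rewrite lt_min => /andP[lam_g1 lam_delta].
have g0 : 0 < enorm (g k) by exact: lt_le_trans eg.
have lamk := lam0 k.
have short : lam k < g1.
  rewrite -(ltr_pM2r (exprn_gt0 2 e0)); apply: le_lt_trans lam_g1.
  rewrite ler_pM2l// lerXn2r ?nnegrE ?(ltW e0) ?(ltW g0)//.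
have [xi near_xi far_grad] := run_short_step run short.
have : `|grad f xi - g k| < b * e.
  apply: modulus => //; apply: le_lt_trans near_xi _.
  rewrite -(ltr_pM2r e0); rewrite ltr_pdivlMr// in lam_delta.
  apply: le_lt_trans lam_delta.
  rewrite -[B * _ * e]mulrA [B * _]mulrC ler_pM2r// -mulrA ler_pM2l//.
  by rewrite expr2 ler_pM2l.
apply/negP; rewrite -leNgt; apply: le_trans far_grad.
by rewrite ler_pM2l.
Qed.

Lemma run_grad_cvg0 : unif_continuous (grad f) -> cvgn (fun k => f (x k)) ->
  enorm (g k) @[k --> \oo] --> 0.
Proof.
move=> uc fcvg; apply/cvgr0Pnorm_lt => e e0.
have ent : entourage [set z : 'rV[R]_n * 'rV[R]_n | ball z.1 (b * e) z.2].
  by rewrite -entourage_ballE; exists (b * e) => //=; rewrite mulr_gt0.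
have := uc _ ent.
rewrite -entourage_ballE => -[delta /= delta0 Hdelta].
have [|K HK] := run_grad_small (K := 0) fcvg e0 delta0; last first.
  by exists K => // k /= Kk; rewrite ger0_norm ?enorm_ge0//; exact: HK.
move=> k xi _ xi_delta.
have /= : ball xi delta (x k) by rewrite -ball_normE.
move=> /(Hdelta (xi, x k)) /=.
by rewrite -ball_normE.
Qed.

(** While the gradient is at least [e], a displacement of order [lam * |g|] is
at most [1 / e] times the decrease of [f], of order [lam * |g|^2]. The decreases
telescope, so the iterates are Cauchy. *)
Lemma run_cvg (e : R) (K : nat) : cvgn (fun k => f (x k)) -> 0 < e ->
  (forall k, (K <= k)%N -> e <= enorm (g k)) -> cvgn x.
Proof.
move=> fcvg e0 ge.
have Ac0 : 0 < A / (c * e) by rewrite divr_gt0// mulr_gt0.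
have move_le k : (K <= k)%N ->
    `|x k.+1 - x k| <= A / (c * e) * (f (x k) - f (x k.+1)).
  move=> Kk; apply: le_trans (run_move run k) _.
  rewrite -mulrA ler_pM2l// ler_pdivlMl ?mulr_gt0//.
  apply: le_trans (run_decrease run k).
  rewrite -mulrA ler_pM2l// mulrCA ler_pM2l// expr2 ler_wpM2r ?enorm_ge0//.
  exact: ge.
have dist_le k m : (K <= k <= m)%N ->
    `|x m - x k| <= A / (c * e) * (f (x k) - f (x m)).
  move=> /andP[Kk /subnK <-]; elim: (m - k)%N => [|j IH].
    by rewrite add0n !subrr normr0 mulr0.
  rewrite addSn -(subrKA (x (j + k)%N) (x _.+1)).
  apply: le_trans (ler_normD _ _) _.
  have Kj : (K <= j + k)%N by rewrite (leq_trans Kk)// leq_addl.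
  by move: (lerD (move_le _ Kj) IH); rewrite -mulrDr [_ - _ + (_ - _)]addrC subrKA.
apply: cauchy_cvg; apply: cauchy_exP => eps eps0.
have eta0 : 0 < eps / (A / (c * e)) by rewrite divr_gt0.
have [K1 HK1] := run_cauchy fcvg eta0.
exists (x (maxn K K1)); exists (maxn K K1) => // m /= Km.
rewrite -ball_normE /= distrC; apply: le_lt_trans (dist_le _ _ _) _.
  by rewrite leq_maxl.
by rewrite mulrC -ltr_pdivlMr//; apply: HK1; rewrite leq_maxr.
Qed.

Lemma run_grad_frequently_small : continuous (grad f) ->
  cvgn (fun k => f (x k)) ->
  forall e K, 0 < e -> exists2 k, (K <= k)%N & enorm (g k) < e.
Proof.
move=> gc fcvg e K e0; apply: contrapT => none.
have ge k : (K <= k)%N -> e <= enorm (g k).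
  by move=> Kk; rewrite leNgt; apply/negP => ?; apply: none; exists k.
have xcvg := run_cvg fcvg e0 ge.
set l := limn x in xcvg.
have be0 : 0 < b * e / 2 by rewrite divr_gt0// mulr_gt0.
have [r /= r0 Hr] : exists2 r, 0 < r &
    forall z, `|l - z| < r -> `|grad f l - grad f z| < b * e / 2.
  have /cvgrPdist_lt /(_ _ be0) /nbhs_ballP [r /= r0 Hr] := gc l.
  by exists r => // z lz; apply: Hr; rewrite -ball_normE.
have r20 : 0 < r / 2 by rewrite divr_gt0.
have /cvgrPdist_lt /(_ _ r20) [K1 _ HK1] := xcvg.
have [|K' HK'] := run_grad_small (K := K1) fcvg e0 r20.
  move=> k xi K1k xi_near; have /= lx := HK1 k K1k.
  rewrite (splitr (b * e)); rewrite -(subrKA (grad f l)).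
  apply: le_lt_trans (ler_normD _ _) _; apply: ltrD; last first.
    apply: Hr; apply: lt_trans lx _; lra.
  rewrite distrC; apply: Hr; rewrite (splitr r) -(subrKA (x k)).
  by apply: le_lt_trans (ler_normD _ _) _; apply: ltrD; rewrite // distrC.
have := HK' _ (leq_maxr K K'); rewrite ltNge ge//; exact: leq_maxl.
Qed.

End DescentRun.

(** * Limit inferior of a nonnegative sequence *)

Lemma limn_einf_eq0 (R : realType) (u : nat -> R) :
  (forall k, 0 <= u k) ->
  (forall e K, 0 < e -> exists2 k, (K <= k)%N & u k < e) ->
  limn_einf (fun k => (u k)%:E) = 0%E.
Proof.
move=> u0 usmall; apply/eqP; rewrite eq_le [limn_einf _]limf_einfE.
apply/andP; split.
  apply: ge_ereal_sup => _ [V [K _ KV] <-].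
  apply/lee_addgt0Pr => e e0; rewrite add0e.
  have [k Kk uk] := usmall e K e0.
  apply: (@le_trans _ _ (u k)%:E); last by rewrite lee_fin ltW.
  by apply: ereal_inf_lbound; exists k => //; exact: KV.
apply: (@le_trans _ _ (ereal_inf ((fun k => (u k)%:E) @` setT))).
  by apply: le_ereal_inf_tmp => _ [k _ <-]; rewrite lee_fin.
by apply: ereal_sup_ubound; exists setT => //; exact: filterT.
Qed.

(** * One iteration of the algorithm *)

(** Since [sigma1 < 1 < sigma2] and [beta] lies in [[alpha_min, alpha_max]], both
safeguards do too: the lower one is at most [beta] or [alpha_min], the upper one
at least [beta] or [alpha_max]. *)
Lemma truncated_step_bounds (R : realType) (P : tbb_params R) (alpha beta : R) :
  alpha_min P <= beta <= alpha_max P ->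
  alpha_min P <= truncated_step P alpha beta <= alpha_max P.
Proof.
move=> /andP[minb bmax]; rewrite /truncated_step.
have b0 : 0 < beta := lt_le_trans (alpha_min_gt0 P) minb.
rewrite (gtr0_norm b0).
set lo := Num.max _ _; set hi := Num.min _ _.
have min_lo : alpha_min P <= lo by rewrite le_max lexx.
have hi_max : hi <= alpha_max P by rewrite ge_min lexx.
have lo_max : lo <= alpha_max P.
  rewrite ge_max ltW ?alpha_min_lt_max//=; apply: le_trans bmax.
  by rewrite ler_piMl ?(ltW b0)//; have /andP[_ /ltW] := sigma1_bounds P.
have min_hi : alpha_min P <= hi.
  rewrite le_min ltW ?alpha_min_lt_max//=; apply: le_trans minb _.
  by rewrite ler_peMl ?(ltW b0)//; have /andP[/ltW] := sigma2_bounds P.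
case: ifPn => [/andP[lo_a a_hi]|_].
  by rewrite (le_trans min_lo lo_a) (le_trans a_hi hi_max).
by case: ifPn => _; rewrite ?min_lo ?min_hi.
Qed.

Section Iteration.
Context (R : realType) (n : nat) (P : tbb_params R) (f : 'rV[R]_n -> R).
Context (a L lam : R) (x : 'rV[R]_n).
Local Notation g := (grad f x).
Local Notation d := (- a *: g).
Local Notation slope := (dot g d + 1 / (2 * a) * L * enorm d ^+ 2).
Hypothesis (df : forall z, differentiable f z).
Hypothesis (abounds : alpha_min P <= a <= alpha_max P).
Hypothesis (g_neq0 : g != 0).
Hypothesis (Lbounds : 0 <= L <= a * (- dot g d) / enorm d ^+ 2).
Hypothesis (lam0 : 0 < lam).
Hypothesis (accept : acceptable_step P f x d a L lam).

Let a0 : 0 < a.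
Proof. by have /andP[+ _] := abounds; apply: lt_le_trans (alpha_min_gt0 P). Qed.

Let g0 : 0 < enorm g. Proof. exact: enorm_gt0. Qed.

Let slopeE : slope = - (a * enorm g ^+ 2) * (1 - L / 2).
Proof.
rewrite sqr_enorm dotZr dotZl dotZr sqr_enorm; field.
exact: lt0r_neq0.
Qed.

(* The upper bound for L is a * (a |g|^2) / (a |g|)^2 = 1. *)
Let L_le1 : L <= 1.
Proof.
have /andP[_] := Lbounds; rewrite dotZr sqr_enorm dotZl dotZr -sqr_enorm.
set G := enorm g ^+ 2; have G0 : 0 < G by rewrite exprn_gt0.
suff -> : a * - (- a * G) / (- a * (- a * G)) = 1 by [].
by field; rewrite !lt0r_neq0.
Qed.

Lemma slope_bounds : - (a * enorm g ^+ 2) <= slope <= - (a * enorm g ^+ 2) / 2.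
Proof.
rewrite slopeE; have aG : 0 < a * enorm g ^+ 2 by rewrite mulr_gt0 ?exprn_gt0.
have := L_le1; have /andP[L0 _] := Lbounds.
by move=> L1; apply/andP; split; nra.
Qed.

Lemma tbb_decrease :
  mu1 P * alpha_min P / 2 * (lam * enorm g ^+ 2) <= f x - f (x + lam *: d).
Proof.
have [+ _] := accept; have /andP[_] := slope_bounds; rewrite /=.
set sl := (_ + _ * enorm _ ^+ 2) => sl_le decr; have /andP[mina _] := abounds.
have /andP[mu10 _] := mu1_bounds P.
have aG : alpha_min P * enorm g ^+ 2 <= a * enorm g ^+ 2.
  by rewrite ler_wpM2r ?sqr_ge0.
have : mu1 P * lam * (alpha_min P * enorm g ^+ 2 / 2) <= mu1 P * lam * - sl.
  by rewrite ler_pM2l ?mulr_gt0//; lra.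
lra.
Qed.

Lemma tbb_displacement_le (t : R) : 0 <= t ->
  `|t *: d| <= alpha_max P * (t * enorm g).
Proof.
move=> t0; rewrite !normrZ normrN (gtr0_norm a0) (ger0_norm t0) mulrCA.
have /andP[_ amax] := abounds.
by rewrite ler_pM ?mulr_ge0 ?(ltW a0)// ler_wpM2l// norm_le_enorm.
Qed.

(** A step below [gamma1] was accepted because a trial step [lam'], at most
[lam / gamma2], violated the descent test with constant [mu2]. The mean value
point [xi] on that trial segment has [<grad f xi, g> < mu2 * |g|^2], whereas
[<g, g> = |g|^2]; the gap [(1 - mu2) * |g|^2] must come from [grad f xi - g].
The denominator [n.+1] stands for the factor [n] of [norm_dot_le] and is
nonzero in every dimension. *)
Lemma tbb_short_step : lam < gamma1 P ->
  exists2 xi, `|xi - x| <= alpha_max P / gamma2 P * (lam * enorm g) &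
    (1 - mu2 P) / n.+1%:R * enorm g <= `|grad f xi - g|.
Proof.
move=> short; have [_ /=] := accept; have /andP[+ _] := slope_bounds.
set sl := (_ + _ * enorm _ ^+ 2) => sl_ge.
have gam0 := gamma2_gt0 P; have /andP[mu20 mu21] := mu2_bounds P.
have amax0 := lt_trans (alpha_min_gt0 P) (alpha_min_lt_max P).
case=> [|[lam' [lam'_le + too_long]]]; first by rewrite leNgt short.
rewrite pmulr_rgt0// => lam'0.
have [t /andP[t0 t_lam'] mvt] := MVT_grad x d df lam'0.
exists (x + t *: d).
  rewrite [x + _]addrC addrK; apply: le_trans (tbb_displacement_le (ltW t0)) _.
  rewrite -mulrA ler_pM2l// mulrA ler_pM2r// ler_pdivlMl//.
  by apply: le_trans lam'_le; rewrite ler_pM2l// ltW.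
set gx := grad f (x + t *: d) in mvt *.
have gxg : dot gx g < mu2 P * enorm g ^+ 2.
  have : mu2 P * sl < dot gx d by rewrite -(ltr_pM2l lam'0); lra.
  rewrite dotZr => mu2sl; rewrite -(ltr_pM2l a0).
  have : mu2 P * - (a * enorm g ^+ 2) <= mu2 P * sl by rewrite ler_pM2l.
  lra.
have gapg : (1 - mu2 P) * enorm g ^+ 2 <= n.+1%:R * (`|gx - g| * enorm g).
  apply: (@le_trans _ _ `|dot (gx - g) g|).
    rewrite dotBl -sqr_enorm distrC; apply: le_trans (ler_norm _); lra.
  apply: le_trans (norm_dot_le _ _) _.
  by rewrite ler_wpM2r ?mulr_ge0 ?(ltW g0)// ler_nat.
rewrite mulrAC ler_pdivrMr// [leRHS]mulrC -(ler_pM2r g0) -!mulrA -expr2.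
exact: gapg.
Qed.

End Iteration.

(** * Convergence of the algorithm *)

Lemma tbb_descent_run (R : realType) (n : nat) (f : 'rV[R]_n -> R)
    (P : tbb_params R) (v : tbb_variant)
    (x : nat -> 'rV[R]_n) (abar L : nat -> R) (p : nat -> nat) :
  (forall z, differentiable f z) ->
  alpha_min P <= 1 <= alpha_max P ->
  tbb_sequence P f v x abar L p ->
  descent_run f x (fun k => omega P ^+ p k) (mu1 P * alpha_min P / 2)
    (alpha_max P) (gamma1 P) (alpha_max P / gamma2 P)
    ((1 - mu2 P) / n.+1%:R).
Proof.
move=> df h1 [abar0 [step update]].
have abounds k : alpha_min P <= abar k <= alpha_max P.
  case: k => [|k]; first by rewrite abar0.
  by have [_ _ beta ->] := update k; exact: truncated_step_bounds.
have lam0 k : 0 < omega P ^+ p k.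
  by rewrite exprn_gt0//; have /andP[] := omega_bounds P.
have amin0 := alpha_min_gt0 P.
have amax0 := lt_trans amin0 (alpha_min_lt_max P).
have /andP[mu10 _] := mu1_bounds P; have /andP[_ mu21] := mu2_bounds P.
split=> // [||||k|k|k].
- by rewrite divr_gt0 ?mulr_gt0.
- exact: gamma1_gt0.
- by rewrite divr_gt0 ?gamma2_gt0.
- by rewrite divr_gt0// subr_gt0.
all: have [gk Lk acc _ xE] := step k.
- rewrite xE; exact: tbb_decrease acc.
- rewrite xE [x k + _]addrC addrK.
  by apply: tbb_displacement_le => //; exact: ltW.
- exact: tbb_short_step acc.
Qed.

Theorem theorem1 (R : realType) (n : nat) (f : 'rV[R]_n -> R)
    (P : tbb_params R) (v : tbb_variant)
    (x : nat -> 'rV[R]_n) (abar L : nat -> R) (p : nat -> nat)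
    (hf : continuously_differentiable f)
    (h1 : alpha_min P <= 1 <= alpha_max P)
    (hx : tbb_sequence P f v x abar L p) :
  (f (x k) @[k --> \oo] --> -oo
   \/ limn_einf (fun k => (enorm (grad f (x k)))%:E) = 0%E)
  /\ (unif_continuous (grad f) ->
      f (x k) @[k --> \oo] --> -oo
      \/ enorm (grad f (x k)) @[k --> \oo] --> 0).
Proof.
have [df gradc] := hf.
have run := tbb_descent_run df h1 hx.
have [fNy|fcvg] := run_cvgNy_or_cvg run; first by split=> [|_]; left.
split=> [|uc]; right; last exact: run_grad_cvg0 run uc fcvg.
apply: limn_einf_eq0 => [k|]; first exact: enorm_ge0.
exact: run_grad_frequently_small run gradc fcvg.
Qed.
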